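(* Let $K$ be a field and let $I \subset R = K[x,y,z]$ be a level Artinian monomial almost complete intersection. Then the Hilbert function of $R/I$ is peaked strictly unimodal.
   Context: $R=K[x,y,z]$ carries the standard grading. An ideal $I\subset R$ is a level Artinian monomial almost complete intersection if $I$ is a proper ideal generated by monomials, $R/I$ is Artinian (finite-dimensional over $K$), $I$ is minimally generated by $4$ elements (one more than its height $3$), and $R/I$ is level, i.e. its socle $\{a\in R/I : (x,y,z)a=0\}$ is concentrated in a single degree $e$, the socle degree. (Up to a permutation of the variables, these ideals have the form $I=(x^{\alpha+t},y^{\beta+t},z^{\gamma+t},x^\alpha y^\beta z^\gamma)$ with integers $0\le\alpha\le\beta\le\gamma$ and $t>0$.) The Hilbert function of $R/I$ is $h(d)=\dim_K [R/I]_d$. It is called peaked strictly unimodal if there are integers $s\ge 0$ and $p\ge 1$ with $s+p-1\le e$ such that $$h(0)<h(1)<\cdots<h(s)=h(s+1)=\cdots=h(s+p-1)>h(s+p)>\cdots>h(e),$$ where $e$ is the socle degree of $R/I$; the degrees $s,\ldots,s+p-1$ are called the peak degrees. *)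

(* Defs.v *)
From Stdlib Require Import ClassicalEpsilon.
From HB Require Import structures.
From mathcomp Require Import all_boot all_order all_algebra.
From mathcomp Require Import mpoly.

Set Implicit Arguments.
Unset Strict Implicit.
Unset Printing Implicit Defensive.

Import GRing.Theory.
Local Open Scope ring_scope.
Local Open Scope quotient_scope.

Section QuotientModule.
Context (K : fieldType) (n : nat) (I : idealr {mpoly K[n]}).
Local Notation Q := {ideal_quot I}.

(* The K-vector space structure of R/I, through K -> R -> R/I. *)
Definition quot_scale (c : K) (a : Q) : Q := \pi_Q (c%:MP_[n]) * a.

Fact quot_scaleA c d a : quot_scale c (quot_scale d a) = quot_scale (c * d) a.
Proof. by rewrite /quot_scale mulrA -rmorphM -mpolyCM. Qed.

Fact quot_scale1 : left_id 1 quot_scale.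
Proof. by move=> a; rewrite /quot_scale mpolyC1 rmorph1 mul1r. Qed.

Fact quot_scaleDr : right_distributive quot_scale +%R.
Proof. by move=> c a b; rewrite /quot_scale mulrDr. Qed.

Fact quot_scaleDl a : {morph quot_scale^~ a : c d / c + d}.
Proof. by move=> c d; rewrite /quot_scale mpolyCD rmorphD mulrDl. Qed.

HB.instance Definition _ := GRing.Zmodule_isLmodule.Build K Q
  quot_scaleA quot_scale1 quot_scaleDr quot_scaleDl.
End QuotientModule.

Section Dimension.
Context (K : fieldType) (V : lmodType K).
Implicit Types W : V -> Prop.

Definition is_basis W m (b : 'I_m -> V) : Prop :=
  (forall v, W v <-> exists c : 'rV[K]_m, v = \sum_(i < m) c 0 i *: b i) /\
  (forall c : 'rV[K]_m, \sum_(i < m) c 0 i *: b i = 0 -> c = 0).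

Definition has_dim W (m : nat) : Prop := exists b : 'I_m -> V, is_basis W b.

Definition finite_dim W : Prop := exists m, has_dim W m.

(* Unspecified when W is not a finite-dimensional subspace. *)
Definition dimK W : nat := epsilon (inhabits 0%N) (has_dim W).
End Dimension.

Section Ideals.
Context (K : fieldType) (n : nat) (I : idealr {mpoly K[n]}).
Local Notation R := {mpoly K[n]}.
Local Notation Q := {ideal_quot I}.

Definition ideal_gen (S : R -> Prop) (p : R) : Prop :=
  exists s : seq (R * R),
    (forall u, u \in s -> S u.2) /\ p = \sum_(u <- s) u.1 * u.2.

Definition generates (S : R -> Prop) : Prop :=
  forall p, p \in I <-> ideal_gen S p.

Definition monomial_ideal : Prop :=
  exists M : 'X_{1..n} -> Prop, generates (fun p => exists2 m, M m & p = 'X_[m]).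

(* Least number of generators.  For a homogeneous ideal this is the size of
   every irredundant system of homogeneous generators. *)
Definition minimally_generated_by (m : nat) : Prop :=
  (exists2 G : seq R, size G = m & generates (fun p => p \in G)) /\
  (forall G : seq R, generates (fun p => p \in G) -> (m <= size G)%N).

(* The image of [R]_d, which is [R/I]_d when I is homogeneous. *)
Definition quot_piece (d : nat) (a : Q) : Prop :=
  exists2 p : R, p \is d.-homog & a = \pi_Q p.

(* For a finitely generated K-algebra, Artinian means finite-dimensional. *)
Definition artinian_quot : Prop := finite_dim (fun _ : Q => True).

Definition socle (a : Q) : Prop := forall i : 'I_n, \pi_Q 'X_i * a = 0.

(* The socle of a nonzero Artinian graded quotient is nonzero, so e is unique:
   it is the socle degree. *)
Definition level_quot (e : nat) : Prop := forall a, socle a -> quot_piece e a.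

(* The piece of degree d is spanned by the classes of the finitely many
   monomials of degree d, so dimK is a genuine dimension here. *)
Definition hilbert (d : nat) : nat := dimK (quot_piece d).
End Ideals.

(* Properness is part of idealr.  An Artinian quotient of K[x,y,z] forces height
   3, so almost complete intersection means 4 minimal generators. *)
Definition level_artinian_monomial_aci (K : fieldType)
    (I : idealr {mpoly K[3]}) (e : nat) : Prop :=
  [/\ monomial_ideal I, artinian_quot I, minimally_generated_by I 4
    & level_quot I e].

Definition peaked_strictly_unimodal (h : nat -> nat) (e : nat) : Prop :=
  exists s p : nat,
    [/\ (1 <= p)%N /\ (s + p - 1 <= e)%N,
        forall i, (i < s)%N -> (h i < h i.+1)%N,
        forall i, (s <= i)%N -> (i < s + p - 1)%N -> h i = h i.+1
      & forall i, (s + p - 1 <= i)%N -> (i < e)%N -> (h i.+1 < h i)%N].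

(* Main.v *)
Require Import Defs.
From Stdlib Require Import ClassicalEpsilon.
From HB Require Import structures.
From mathcomp Require Import all_boot all_order all_algebra.
From mathcomp Require Import mpoly zify.

(* Let U be the set of monomials in I.  A monomial ideal is determined by U, and
   h(d) counts the monomials of degree d outside U.  Since I/mI has the minimal
   monomials of U as a basis, I = (x^a, y^b, z^c, x^al y^be z^ga), and the
   monomials outside U form a box minus a translated smaller box.  Levelness
   forces a - al = b - be = c - ga, except that one of al, be, ga may vanish,
   in which case the corresponding difference is free.  The first difference of
   h is then an explicit piecewise linear function, and a case analysis on its
   breakpoints shows that up to degree e it stays nonpositive once it is
   nonpositive, and negative once it is negative. *)

Set Implicit Arguments.
Unset Strict Implicit.
Unset Printing Implicit Defensive.

Import GRing.Theory.
Local Open Scope ring_scope.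

(** * Linear independence and well-defined dimension *)

Section LinearAlgebra.
Context (K : fieldType) (V : lmodType K).
Implicit Types W : V -> Prop.

Definition lin_indep m (v : 'I_m -> V) : Prop :=
  forall c : 'rV[K]_m, \sum_(i < m) c 0 i *: v i = 0 -> c = 0.

(** A row in the left kernel of the coordinate matrix is a vanishing combination of the [v i], so
    the matrix has full row rank [k], at most its number [m] of columns. *)
Lemma lin_indep_le_dim W m k (v : 'I_k -> V) :
  has_dim W m -> (forall i, W (v i)) -> lin_indep v -> (k <= m)%N.
Proof.
case=> b [span_b _] Wv free_v.
have /fin_all_exists[C vE] i : exists c : 'rV[K]_m, v i = \sum_j c 0 j *: b j.
  exact/span_b.
pose A := \matrix_(i < k) C i.
suff kerA : kermx A = 0.
  have := mxrank_ker A; rewrite kerA mxrank0.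
  by have := rank_leq_col A; have := rank_leq_row A; lia.
apply/row_matrixP=> i; rewrite row0; apply: free_v.
have : row i (kermx A) *m A = 0 by rewrite -row_mul mulmx_ker row0.
set c := row i _ => cA0.
transitivity (\sum_j (c *m A) 0 j *: b j); last first.
  by rewrite cA0 big1 // => j _; rewrite mxE scale0r.
under eq_bigr => j _ do rewrite vE scaler_sumr.
rewrite exchange_big; apply: eq_bigr => j _; rewrite mxE scaler_suml.
by apply: eq_bigr => l _; rewrite scalerA [A _ _]mxE.
Qed.

Lemma has_dim_uniq W m k : has_dim W m -> has_dim W k -> m = k.
Proof.
have le m' k' : has_dim W m' -> has_dim W k' -> (m' <= k')%N.
  case=> b [span_b free_b] Wk; apply: (lin_indep_le_dim Wk (v := b)) => // i.
  apply/span_b; exists (delta_mx 0 i); rewrite (bigD1 i) //= !mxE !eqxx scale1r.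
  by rewrite big1 ?addr0 // => j /negPf ji; rewrite mxE ji andbF scale0r.
by move=> Wm Wk; apply/eqP; rewrite eqn_leq !le.
Qed.

(** Uniqueness makes the choice by [epsilon] immaterial: any basis computes [dimK]. *)
Lemma dimKE W m : has_dim W m -> dimK W = m.
Proof.
move=> Wm; apply: (has_dim_uniq _ Wm).
by apply: epsilon_spec; exists m.
Qed.
End LinearAlgebra.

(** * Monomial ideals, their quotients and socles *)

Section MonomialIdeals.
Context (K : fieldType) (n : nat) (I : idealr {mpoly K[n]}).
Local Notation R := {mpoly K[n]}.
Local Notation Q := {ideal_quot I}.
Local Notation pi := (\pi_Q)%qT.

Lemma pi_eqE (p q : R) : (pi p = pi q) <-> (p - q \in I).
Proof. by rewrite Quotient.idealrBE; split=> [->|/eqP]. Qed.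

Lemma pi_eq0 (p : R) : (pi p = 0) <-> (p \in I).
Proof. by rewrite -(subr0 p) -pi_eqE rmorph0 subr0. Qed.

Lemma piZ c (p : R) : c *: pi p = pi (c *: p).
Proof. by rewrite -mul_mpolyC rmorphM. Qed.

Lemma pi_lincomb m (c : 'I_m -> K) (f : 'I_m -> R) :
  \sum_i c i *: pi (f i) = pi (\sum_i c i *: f i).
Proof. by rewrite rmorph_sum; apply: eq_bigr => i _; rewrite piZ. Qed.

Lemma monomial_mem_le (m k : 'X_{1..n}) :
  (m <= k)%MM -> 'X_[m] \in I -> 'X_[k] \in I.
Proof. by move=> /submK <- Im; rewrite mpolyXD idealMr. Qed.

Lemma one_notin_ideal : 'X_[0%MM] \notin I.
Proof. by rewrite mpolyX0 idealr1. Qed.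

Lemma mcoeffMX_le (q : R) (k m : 'X_{1..n}) :
  (q * 'X_[k])@_m = if (k <= m)%MM then q@_(m - k)%MM else 0.
Proof.
case: ifP => [km|/negP km]; first by rewrite -{1}(submK km) addmC mcoeffMX.
apply: memN_msupp_eq0; rewrite (perm_mem (msuppMX q k)).
by apply/mapP => -[l _ mE]; apply: km; rewrite mE lem_addr.
Qed.

Hypothesis monI : monomial_ideal I.

(** A nonzero coefficient at [m] must come from a term whose monomial generator divides ['X_[m]]. *)
Lemma mcoeff_ideal (p : R) m : p \in I -> p@_m != 0 -> 'X_[m] \in I.
Proof.
case: monI => M genM /genM[s [sM ->]] nz.
suff [u us um] : exists2 u : R * R, u \in s & (u.1 * u.2)@_m != 0.
  have [k Mk uE] := sM u us; move: um; rewrite uE mcoeffMX_le.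
  case: ifP => [km _|_]; last by rewrite eqxx.
  apply: (monomial_mem_le km); apply/genM; exists [:: (1, 'X_[k])].
  by split=> [v|]; rewrite ?inE ?big_seq1 ?mul1r // => /eqP ->; exists k.
apply/hasP; apply: contraNT nz => /hasPn s0; rewrite raddf_sum big_seq.
by apply/eqP/big1 => u us; apply/eqP; have := s0 u us; rewrite negbK.
Qed.

Lemma mem_monomial_ideal (p : R) :
  (p \in I) <-> (forall m, m \in msupp p -> 'X_[m] \in I).
Proof.
split=> [pI m|Im]; first by rewrite mcoeff_msupp; apply: mcoeff_ideal.
rewrite (mpolyE p) big_seq; apply: rpred_sum => m mp.
by rewrite -mul_mpolyC idealMr // Im.
Qed.

Lemma monomials_lin_indep k (f : 'I_k -> 'X_{1..n}) :
    injective f -> (forall i, 'X_[f i] \notin I) ->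
  lin_indep (fun i => pi 'X_[f i]).
Proof.
move=> f_inj fI c; rewrite pi_lincomb => /pi_eq0 sumI.
apply/rowP => i; rewrite mxE; apply/eqP/negPn/negP => ci.
case/negP: (fI i); apply: (mcoeff_ideal sumI); rewrite raddf_sum /=.
rewrite (bigD1 i) //= mcoeffZ mcoeffX eqxx mulr1 big1 ?addr0 // => j ji.
by rewrite mcoeffZ mcoeffX (inj_eq f_inj) (negPf ji) mulr0.
Qed.

Lemma hilbert_monomial (d : nat) (ms : seq 'X_{1..n}) :
    uniq ms ->
    (forall m, (m \in ms) = (mdeg m == d) && ('X_[m] \notin I)) ->
  hilbert I d = size ms.
Proof.
move=> ms_uniq msE; apply: dimKE.
pose f (i : 'I_(size ms)) := nth 0%MM ms i.
have fms i : f i \in ms by apply: mem_nth.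
have f_inj : injective f.
  by move=> i j /eqP; rewrite nth_uniq // => /eqP/val_inj.
exists (fun i => pi 'X_[f i]); split; last first.
  by apply: monomials_lin_indep => // i; have := fms i; rewrite msE => /andP[].
move=> v; split=> [[p p_hom ->]|[c ->]].
  (* The coordinates are the coefficients of [p] outside [I]; the remainder is supported on
     monomials of [I], since [p] has none of degree other than [d]. *)
  exists (\row_i p@_(f i)); under eq_bigr => i _ do rewrite mxE.
  rewrite pi_lincomb; apply/pi_eqE/mem_monomial_ideal => m.
  rewrite mcoeff_msupp mcoeffB raddf_sum /= => nz.
  apply: contraNT nz => mI.
  under eq_bigr => i _ do rewrite mcoeffZ mcoeffX.
  have [|m_ms] := boolP (m \in ms).
    move/(nthP 0%MM) => [i i_lt mE]; rewrite -mE (bigD1 (Ordinal i_lt)) //=.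
    rewrite eqxx mulr1 big1 ?addr0 ?subrr // => j ji.
    rewrite (_ : nth _ _ _ = f (Ordinal i_lt)) //.
    by rewrite (inj_eq f_inj) (negPf ji) mulr0.
  rewrite big1 ?subr0 => [|i _]; last first.
    case: eqP => [fim|_]; last by rewrite mulr0.
    by rewrite -fim fms in m_ms.
  move: m_ms; rewrite msE mI andbT => md.
  by rewrite (dhomog_nemf_coeff p_hom).
exists (\sum_i c 0 i *: 'X_[f i]); last by rewrite pi_lincomb.
apply: rpred_sum => i _; apply: rpredZ; rewrite dhomogX.
by have := fms i; rewrite msE => /andP[].
Qed.

(** Otherwise the first [m.+1] powers of the variable would be independent in a quotient of
    dimension [m]. *)
Lemma artinian_power (i : 'I_n) :
  artinian_quot I -> exists k, 'X_[U_(i) *+ k] \in I.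
Proof.
case=> m dim_m; apply: NNPP => noPower.
have nI k : 'X_[U_(i) *+ k] \notin I by apply/negP => kI; apply: noPower; exists k.
have inj : injective (fun k : 'I_m.+1 => (U_(i) *+ k)%MM).
  move=> k l /(congr1 (fun m : 'X_{1..n} => mdeg m)).
  by rewrite !mdegMn mdeg1 !mul1n => /val_inj.
have := lin_indep_le_dim dim_m (fun _ => Logic.I)
          (monomials_lin_indep inj (fun k => nI k)).
by rewrite ltnn.
Qed.

(** Levelness gives a form [p] of degree [e] with ['X_[m] - p] in [I]. In any other degree, [p]
    could not cancel the coefficient 1 at [m], which would put ['X_[m]] in [I]. *)
Lemma level_socle_deg e (m : 'X_{1..n}) :
    level_quot I e -> 'X_[m] \notin I ->
    (forall i, 'X_[m + U_(i)] \in I) -> mdeg m = e.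
Proof.
move=> lev mI mS.
have [|p p_hom /pi_eqE pI] := lev (pi 'X_[m]).
  by move=> i; rewrite -rmorphM mulrC -mpolyXD; apply/pi_eq0.
apply/eqP/negPn/negP => md; case/negP: mI; apply: (mcoeff_ideal pI).
by rewrite mcoeffB mcoeffX eqxx (dhomog_nemf_coeff p_hom) // subr0 oner_eq0.
Qed.

(** * Minimal monomials and the number of generators *)

Definition minimal_monomial (m : 'X_{1..n}) : Prop :=
  'X_[m] \in I /\ forall k, (k <= m)%MM -> 'X_[k] \in I -> k = m.

(* [I/mI] has the classes of the minimal monomials as a basis: on [I], the
   coefficient of a minimal monomial only sees the constant terms of the
   multipliers. *)
Lemma mcoeffM_minimal (p q : R) m :
  minimal_monomial m -> q \in I -> (p * q)@_m = p@_0%MM * q@_m.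
Proof.
move=> [mI m_min] qI; rewrite {1}(mpolyE q) mulr_sumr raddf_sum /=.
transitivity (\sum_(k <- msupp q) p@_0%MM * (q@_k *+ (k == m))); last first.
  rewrite -mulr_sumr; congr (_ * _); have [mq|mq] := boolP (m \in msupp q).
    rewrite (bigD1_seq m) //= eqxx mulr1n big1 ?addr0 // => k /negPf ->.
    by rewrite mulr0n.
  rewrite big_seq (memN_msupp_eq0 mq) big1 // => k kq.
  by case: eqP kq => [->|]; rewrite ?(negPf mq) // mulr0n.
rewrite big_seq [RHS]big_seq; apply: eq_bigr => k kq.
rewrite -scalerAr mcoeffZ mcoeffMX_le mulrC.
have [->|km] := eqVneq k m; last first.
  rewrite mulr0n mulr0; case: ifP => [k_le|]; rewrite ?mul0r //.
  by case/eqP: km; apply: m_min => //; apply: (proj1 (mem_monomial_ideal q)).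
rewrite mulr1n lepm_refl; congr (p@_ _ * _); apply/mnmP => i.
by rewrite mnmBE mnm0E subnn.
Qed.

(** Expressing the minimal monomials through [G] and keeping constant terms of the multipliers
    factors the identity of size [size S] through dimension [size G]. *)
Lemma size_generators_ge (G : seq R) (S : seq 'X_{1..n}) :
    generates I (fun p => p \in G) -> uniq S ->
    (forall m, m \in S -> minimal_monomial m) ->
  (size S <= size G)%N.
Proof.
move=> genG S_uniq S_min.
pose f (i : 'I_(size S)) := nth 0%MM S i.
have f_min i : minimal_monomial (f i) by apply/S_min/mem_nth.
have GI p : p \in G -> p \in I.
  move=> pG; apply/genG; exists [:: (1, p)].
  by split=> [u|]; rewrite ?inE ?big_seq1 ?mul1r // => /eqP ->.
have /fin_all_exists[C CE] (i : 'I_(size S)) : exists c : 'I_(size G) -> K,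
    forall j, \sum_l c l * (nth 0 G l)@_(f j) = (i == j)%:R.
  have [s [sG fE]] := proj1 (genG _) (proj1 (f_min i)).
  (* A generator may occur several times in [s], so terms are grouped by its first position in
     [G]. *)
  exists (fun l : 'I_(size G) => \sum_(u <- s | index u.2 G == l) u.1@_0%MM) => j.
  rewrite -[RHS](_ : 'X_[f i]@_(f j) = _); last first.
    by rewrite mcoeffX nth_uniq.
  rewrite fE raddf_sum /=; under eq_bigr => l _ do rewrite mulr_suml.
  rewrite (exchange_big_dep predT) //= !big_seq.
  apply: eq_bigr => u us; have uG := sG u us.
  rewrite mcoeffM_minimal ?GI //.
  have ul : (index u.2 G < size G)%N by rewrite index_mem.
  rewrite (big_pred1 (Ordinal ul)) /= ?nth_index //.
pose A := \matrix_(i, l) C i l.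
pose B := \matrix_(l < size G, j < size S) (nth 0 G l)@_(f j).
have AB : A *m B = 1%:M.
  apply/matrixP => i j; rewrite !mxE -CE.
  by apply: eq_bigr => l _; rewrite !mxE.
have := mxrankM_maxl A B; rewrite AB mxrank1; have := rank_leq_col A; lia.
Qed.

Lemma minimal_monomial_below m :
  'X_[m] \in I -> exists2 k, (k <= m)%MM & minimal_monomial k.
Proof.
elim: {m}(mdeg m) {-2}m (leqnn (mdeg m)) => [|d IH] m md mI.
  move: md; rewrite leqn0 mdeg_eq0 => /eqP m0.
  by case/negP: one_notin_ideal; rewrite -m0.
have [m_min|m_nmin] := excluded_middle_informative (minimal_monomial m).
  by exists m => //; apply: lepm_refl.
have [k [km kI k_ne]] : exists k, [/\ (k <= m)%MM, 'X_[k] \in I & k <> m].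
  apply: NNPP => nex; apply: m_nmin; split=> // k km kI; apply: NNPP => k_ne.
  by apply: nex; exists k.
have [|l lk l_min] := IH k _ kI; last by exists l => //; apply: lepm_trans km.
rewrite -ltnS; apply: leq_trans md; rewrite -(submK km) mdegD.
rewrite -[X in (X < _)%N]add0n ltn_add2r lt0n mdeg_eq0.
by apply/eqP => mk0; apply: k_ne; rewrite -(submK km) mk0 add0m.
Qed.

(** With [size_generators_ge], this makes the least number of generators equal to the number of
    minimal monomials. *)
Lemma generates_minimal (S : seq 'X_{1..n}) :
    (forall m, minimal_monomial m <-> m \in S) ->
  generates I (fun p => p \in [seq 'X_[m] | m <- S]).
Proof.
move=> S_min p; split=> [pI|[s [sS ->]]]; last first.
  rewrite big_seq; apply: rpred_sum => u /sS /mapP[m /S_min[mI _] ->].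
  exact: idealMr.
have /fin_all_exists[k kE] (i : 'I_(size (msupp p))) :
    exists k, minimal_monomial k /\ (k <= nth 0 (msupp p) i)%MM.
  have [|k k_le k_min] := @minimal_monomial_below (nth 0%MM (msupp p) i).
    by apply: (proj1 (mem_monomial_ideal p)) => //; apply: mem_nth.
  by exists k.
pose g (i : 'I_(size (msupp p))) :=
  (p@_(nth 0%MM (msupp p) i) *: 'X_[nth 0%MM (msupp p) i - k i] : R,
   'X_[k i] : R).
exists [seq g i | i <- enum 'I_(size (msupp p))]; split.
  by move=> u /mapP[i _ ->]; apply/map_f/S_min; case: (kE i).
rewrite big_map big_enum /= {1}(mpolyE p) (big_nth 0%MM) big_mkord.
by apply: eq_bigr => i _; rewrite -scalerAl -mpolyXD submK //; case: (kE i).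
Qed.

Lemma minimal_monomials_finite (a : 'I_n -> nat) :
    (forall i, 'X_[U_(i) *+ a i] \in I) ->
  exists2 S, uniq S & forall m, minimal_monomial m <-> m \in S.
Proof.
(* An exponent above [a i] would make the pure power a proper divisor, so minimal monomials have
   degree below [N] and lie in a finite type. *)
move=> aI; pose N := (\sum_i a i).+1.
pose minb m : bool := excluded_middle_informative (minimal_monomial m).
exists [seq m <- [seq val x | x : 'X_{1..n < N}] | minb m].
  by rewrite filter_uniq // (map_inj_uniq val_inj) enum_uniq.
move=> m; rewrite mem_filter /minb.
case: excluded_middle_informative => m_min /=; last by split.
split=> // _; have m_lt : (mdeg m < N)%N.
  rewrite mdegE ltnS; apply: leq_sum => i _; rewrite leqNgt; apply/negP => ai.
  have /(proj2 m_min)/(_ (aI i)) mE : (U_(i) *+ a i <= m)%MM.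
    apply/mnm_lepP => j; rewrite mulmnE mnm1E.
    by case: eqP => [<-|_]; rewrite ?mul1n ?mul0n // ltnW.
  by move: ai; rewrite -mE mulmnE mnm1E eqxx mul1n ltnn.
by apply/mapP; exists (BMultinom m_lt); rewrite ?mem_enum.
Qed.

(* The pure powers account for [n] of the [n.+1] minimal monomials. *)
Lemma monomial_aci_shape :
    artinian_quot I -> minimally_generated_by I n.+1 ->
  exists (a : 'I_n -> nat) (m0 : 'X_{1..n}),
    [/\ forall i, (m0 i < a i)%N,
        forall i, exists2 j, j != i & (0 < m0 j)%N
      & forall m, 'X_[m] \in I <->
          (exists i, (a i <= m i)%N) \/ (m0 <= m)%MM].
Proof.
move=> art [[G sizeG genG] genS].
have /fin_all_exists[a aP] (i : 'I_n) : exists k,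
    'X_[U_(i) *+ k] \in I /\ forall l, 'X_[U_(i) *+ l] \in I -> (k <= l)%N.
  have [k kI k_min] := ex_minnP (artinian_power i art).
  by exists k.
have aI i : 'X_[U_(i) *+ a i] \in I by case: (aP i).
have a_min i l : 'X_[U_(i) *+ l] \in I -> (a i <= l)%N by case: (aP i) => _; apply.
have a_gt0 i : (0 < a i)%N.
  rewrite lt0n; apply: contraTneq (aI i) => ->.
  by rewrite mulm0n one_notin_ideal.
have pureE i k l : (U_(i) *+ k <= l)%MM = (k <= l i)%N.
  apply/mnm_lepP/idP => [/(_ i)|kl j]; first by rewrite mulmnE mnm1E eqxx mul1n.
  by rewrite mulmnE mnm1E; case: eqP => [<-|_]; rewrite ?mul1n ?mul0n.
have le_pure i k (l : 'X_{1..n}) : (l <= U_(i) *+ k)%MM -> l = (U_(i) *+ l i)%MM.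
  move=> /mnm_lepP l_le; apply/mnmP => j; rewrite mulmnE mnm1E.
  have := l_le j; rewrite mulmnE mnm1E; case: eqP => [<-|_]; rewrite ?mul1n //.
  by rewrite !mul0n leqn0 => /eqP.
have [S S_uniq S_min] := minimal_monomials_finite aI.
pose T := [seq (U_(i) *+ a i)%MM | i : 'I_n].
have T_min i : minimal_monomial (U_(i) *+ a i).
  split=> // k k_le kI; have kE := le_pure _ _ _ k_le; rewrite kE in kI *.
  congr (_ *+ _)%MM; apply/eqP; rewrite eqn_leq a_min // andbT.
  by move: k_le; rewrite kE => /mnm_lepP/(_ i); rewrite !mulmnE mnm1E eqxx !mul1n.
have T_uniq : uniq T.
  rewrite map_inj_uniq ?enum_uniq // => i j ij; apply/eqP.
  have := a_gt0 i; apply: contraTT => ne; rewrite -leqNgt leqn0.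
  have /mnmP/(_ i) := ij; rewrite !mulmnE !mnm1E eqxx mul1n => ->.
  by rewrite [j == i]eq_sym (negPf ne).
have size_T : size T = n by rewrite size_map size_enum_ord.
have size_S : size S = n.+1.
  apply/eqP; rewrite eqn_leq -{1}sizeG (size_generators_ge genG) //=; last first.
    by move=> m /S_min.
  by rewrite -(size_map (fun m => 'X_[m] : R)) genS //; apply: generates_minimal.
have permS : perm_eq S (T ++ [seq m <- S | m \notin T]).
  apply: uniq_perm => //.
    rewrite cat_uniq T_uniq filter_uniq // andbT.
    by apply/hasPn => m; rewrite mem_filter => /andP[].
  move=> m; rewrite mem_cat mem_filter; case: (boolP (m \in T)) => //= mT.
  by apply/S_min; case/mapP: mT => i _ ->.
(* Of the [n.+1] minimal monomials [n] are pure powers, so exactly one, [m0], remains. *)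
case E: [seq m <- S | m \notin T] permS => [|m0 [|? ?]] permS;
  have /perm_size := permS; rewrite size_cat size_T size_S /=; try lia.
move=> _; have {}permS m : (m \in S) = (m \in T) || (m == m0).
  by rewrite (perm_mem permS) mem_cat inE.
have m0T : m0 \notin T.
  have : m0 \in [seq m <- S | m \notin T] by rewrite E mem_head.
  by rewrite mem_filter => /andP[].
have m0_min : minimal_monomial m0 by apply/S_min; rewrite permS eqxx orbT.
have m0_lt i : (m0 i < a i)%N.
  rewrite ltnNge; apply: contraNN m0T => ai.
  rewrite -((proj2 m0_min) (U_(i) *+ a i)%MM) // ?pureE //.
  by apply: map_f; rewrite mem_enum.
exists a, m0; split=> // [i|m].
  (* If no other variable occurred, [m0] would be a pure power in [I], with exponent at least
     [a i]. *)
  apply: NNPP => no_j; have : (a i <= m0 i)%N; last by rewrite leqNgt m0_lt.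
  apply: a_min; apply: monomial_mem_le (proj1 m0_min).
  apply/mnm_lepP => j; rewrite mulmnE mnm1E.
  case: (eqVneq i j) => [<-|ij]; rewrite ?mul1n // mul0n leqNgt.
  by apply/negP => m0j; apply: no_j; exists j; rewrite // eq_sym.
split=> [/minimal_monomial_below[k km]|[[i ai]|]].
- move=> /S_min; rewrite permS => /orP[/mapP[i _ kE]|/eqP kE]; last by right; rewrite -kE.
  by left; exists i; rewrite -pureE -kE.
- by rewrite -pureE in ai; apply: monomial_mem_le ai _.
- by move=> m0m; apply: monomial_mem_le m0m _; case: m0_min.
Qed.

(** The monomial [m] built below is outside [I] but in its socle: multiplying by variable [i]
    reaches a multiple of [m0], and by any other [j] the pure power of exponent [a j]. *)
Lemma socle_deg_shape e (a : 'I_n -> nat) (m0 : 'X_{1..n}) i :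
    level_quot I e -> (forall j, (m0 j < a j)%N) ->
    (forall m, 'X_[m] \in I <-> (exists j, (a j <= m j)%N) \/ (m0 <= m)%MM) ->
    (0 < m0 i)%N ->
  ((m0 i).-1 + \sum_(j | j != i) (a j).-1)%N = e.
Proof.
move=> lev m0_lt memI m0i.
pose m := [multinom (if j == i then (m0 i).-1 else (a j).-1) | j < n].
have <- : mdeg m = ((m0 i).-1 + \sum_(j | j != i) (a j).-1)%N.
  rewrite mdegE (bigD1 i) //= mnmE eqxx; congr addn.
  by apply: eq_bigr => j /negPf ji; rewrite mnmE ji.
apply: level_socle_deg => // [|j].
  apply/negP => /memI[[j]|/mnm_lepP/(_ i)]; rewrite mnmE; last by rewrite eqxx; lia.
  by have := m0_lt j; case: eqP => [->|_]; lia.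
apply/memI; have [->|ji] := eqVneq j i.
  right; apply/mnm_lepP => k; rewrite mnmDE mnmE mnm1E [i == k]eq_sym.
  by have := m0_lt k; case: eqP => [->|_]; lia.
left; exists j; rewrite mnmDE mnmE mnm1E eqxx (negPf ji).
by have := m0_lt j; lia.
Qed.

End MonomialIdeals.

(** * Counting lattice points by degree in boxes and staircases *)

Section BoxCounts.
Local Open Scope nat_scope.

(** [box3 a b c s] is the Hilbert function of $K[x,y,z]/(x^a,y^b,z^c)$ shifted up by [s]; the shift
    lets each box be a sum of boxes of lower dimension. *)
Definition box1 c s d := \sum_(k < c) (s + k == d).
Definition box2 b c s d := \sum_(j < b) box1 c (s + j) d.
Definition box3 a b c s d := \sum_(i < a) box2 b c (s + i) d.

Lemma box1E c s d : box1 c s d = (s <= d < s + c).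
Proof. by elim: c => [|c]; rewrite /box1 ?big_ord0 ?big_ord_recr /=; lia. Qed.

(** Coefficients of $t^s(1-t^b)(1-t^c)/(1-t)^2$, with negative terms moved across the equality. *)
Lemma box2E b c s d :
  box2 b c s d + (d.+1 - (s + b)) + (d.+1 - (s + c)) =
  (d.+1 - s) + (d.+1 - (s + b + c)).
Proof.
elim: b => [|b]; rewrite /box2 ?big_ord0 ?big_ord_recr /= ?box1E; lia.
Qed.

Lemma box2_shift b c s d : box2 b c s.+1 d.+1 = box2 b c s d.
Proof. by have := box2E b c s d; have := box2E b c s.+1 d.+1; lia. Qed.

(** Telescoping: from [d] to [d.+1] the slice at [s] enters and the one at [s + a] leaves. *)
Lemma box3_step a b c s d :
  box3 a b c s d.+1 + box2 b c (s + a) d.+1 = box3 a b c s d + box2 b c s d.+1.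
Proof.
elim: a => [|a]; rewrite /box3 ?big_ord0 ?big_ord_recr /= ?addn0 //.
by rewrite addnS box2_shift; lia.
Qed.

(* At [n = d.+2 - s], [gain] and [loss] are the positive and negative parts of
   the inclusion-exclusion formula for [box3 a b c s d.+1 - box3 a b c s d];
   truncated subtraction plays the role of the positive part. *)
Definition gain a b c n := n + (n - (a + b)) + (n - (a + c)) + (n - (b + c)).
Definition loss a b c n := (n - a) + (n - b) + (n - c) + (n - (a + b + c)).

Lemma box3_diff a b c s d :
  box3 a b c s d.+1 + loss a b c (d.+2 - s) =
  box3 a b c s d + gain a b c (d.+2 - s).
Proof.
move: (box3_step a b c s d) (box2E b c s d.+1) (box2E b c (s + a) d.+1).
rewrite /gain /loss -!subnDA !addnA.
(* The eight truncated differences, one per subset of the three sides, become opaque variables in a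
   linear identity. *)
do 8![match goal with |- context [d.+2 - ?x] => move: (d.+2 - x) end].
lia.
Qed.

Lemma sum_ge p t (F : nat -> nat) :
  \sum_(i < p + t) (p <= i) * F i = \sum_(i < t) F (p + i).
Proof.
rewrite big_split_ord /= big1 ?add0n => [|i _]; last by rewrite leqNgt ltn_ord.
by apply: eq_bigr => i _; rewrite leq_addr mul1n.
Qed.

(* The monomials outside (x^a, y^b, z^c, x^al y^be z^ga) in degree [d]. *)
Definition staircase a b c al be ga d :=
  \sum_(i < a) \sum_(j < b) \sum_(k < c)
    ((i + j + k == d) && ~~ [&& al <= i, be <= j & ga <= k]).

(** The points removed from the large box form a translated box with sides [ta], [tb], [tc]. *)
Lemma staircaseE al be ga ta tb tc d :
  staircase (al + ta) (be + tb) (ga + tc) al be ga d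
    + box3 ta tb tc (al + be + ga) d =
  box3 (al + ta) (be + tb) (ga + tc) 0 d.
Proof.
have -> : box3 ta tb tc (al + be + ga) d =
    \sum_(i < al + ta) \sum_(j < be + tb) \sum_(k < ga + tc)
      ((i + j + k == d) && [&& al <= i, be <= j & ga <= k]).
  (* From the inside out, each lower bound is pulled out as a factor so that [sum_ge] can reindex
     its sum. *)
  under [RHS]eq_bigr => i _.
    under eq_bigr => j _.
      under eq_bigr => k _.
        rewrite (_ : nat_of_bool _ =
                 (ga <= k) * ((al <= i) && (be <= j) && (i + j + k == d))); last lia.
        over.
      rewrite (sum_ge ga tc (fun k => (al <= i) && (be <= j) && (i + j + k == d))).
      rewrite (_ : \sum_ _ _ = (be <= j) *
          \sum_(k < tc) ((al <= i) && (i + j + (ga + k) == d))); last first.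
        by rewrite big_distrr; apply: eq_bigr => k _ /=; lia.
      over.
    rewrite (sum_ge be tb
      (fun j => \sum_(k < tc) ((al <= i) && (i + j + (ga + k) == d)))).
    rewrite (_ : \sum_ _ _ = (al <= i) *
        \sum_(j < tb) \sum_(k < tc) (i + (be + j) + (ga + k) == d)); last first.
      rewrite big_distrr; apply: eq_bigr => j _ /=.
      by rewrite big_distrr; apply: eq_bigr => k _ /=; lia.
    over.
  rewrite (sum_ge al ta
    (fun i => \sum_(j < tb) \sum_(k < tc) (i + (be + j) + (ga + k) == d))).
  apply: eq_bigr => i _; apply: eq_bigr => j _; apply: eq_bigr => k _.
  by congr (nat_of_bool (_ == _)); lia.
rewrite -big_split; apply: eq_bigr => i _.
rewrite -big_split; apply: eq_bigr => j _.
by rewrite -big_split; apply: eq_bigr => k _ /=; lia.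
Qed.

(** * Sign of the first difference of the staircase count *)

Definition rises al be ga ta tb tc n :=
  gain (al + ta) (be + tb) (ga + tc) n + loss ta tb tc (n - (al + be + ga)).
Definition falls al be ga ta tb tc n :=
  loss (al + ta) (be + tb) (ga + tc) n + gain ta tb tc (n - (al + be + ga)).

(** The inner box is subtracted, so its [loss] counts as a rise and its [gain] as a fall. *)
Lemma staircase_diff al be ga ta tb tc d :
  let h := staircase (al + ta) (be + tb) (ga + tc) al be ga in
  h d.+1 + falls al be ga ta tb tc d.+2 = h d + rises al be ga ta tb tc d.+2.
Proof.
move=> h; have := box3_diff (al + ta) (be + tb) (ga + tc) 0 d.
have := box3_diff ta tb tc (al + be + ga) d.
rewrite -!staircaseE -/h subn0 /falls /rises; lia.
Qed.

(** The weak implication forbids a rise after a plateau or descent; the strict one forbids a plateau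
    after a descent. *)
Definition keeps_descending al be ga ta tb tc n :=
  (rises al be ga ta tb tc n <= falls al be ga ta tb tc n ->
   rises al be ga ta tb tc n.+1 <= falls al be ga ta tb tc n.+1) /\
  (rises al be ga ta tb tc n < falls al be ga ta tb tc n ->
   rises al be ga ta tb tc n.+1 < falls al be ga ta tb tc n.+1).

(* [lia] alone explodes on the truncated subtractions of [keeps_descending];
   placing [n] relative to each breakpoint makes every leaf purely linear. *)
Ltac split_at n x :=
  let y := fresh "y" in let H := fresh "H" in
  have [H|[y H]] : n < x \/ exists y, n = x + y by
    [case: (ltnP n x) => H; [left | right; exists (n - x); rewrite subnKC]];
  [ have -> : n - x = 0 by lia | have -> : n - x = y by lia];
  [ have -> : n.+1 - x = 0 by lia | have -> : n.+1 - x = y.+1 by lia];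
  try (exfalso; lia).

Ltac beyond n x :=
  have -> : n - x = 0 by lia; have -> : n.+1 - x = 0 by lia.

Lemma keeps_descending_pos al be ga t n :
    0 < al -> al <= be -> be <= ga -> 0 < n ->
    n.+2 < al + be + ga + 2 * t ->
  keeps_descending al be ga t t t n.
Proof.
move=> al_gt0 al_be be_ga n_gt0 n_lt.
rewrite /keeps_descending /rises /falls /gain /loss -!subnDA.
(* By [n_lt], neither [n] nor [n.+1] passes these breakpoints, so their terms vanish. *)
beyond n (al + be + ga + (t + t)).
beyond n (al + be + ga + (t + t + t)).
beyond n (al + t + (be + t) + (ga + t)).
split_at n (al + be + ga); split_at n (al + t); split_at n (be + t);
  split_at n (ga + t); split_at n (al + be + ga + t);
  split_at n (al + t + (be + t)); split_at n (al + t + (ga + t));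
  split_at n (be + t + (ga + t)).
all: lia.
Qed.

(** When the mixed generator omits a variable, the pure power [a] of that variable is unconstrained
    by [t]. *)
Lemma keeps_descending_zero be ga a t n :
    0 < be -> be <= ga -> 0 < n -> n.+2 < be + ga + t + a ->
  keeps_descending 0 be ga a t t n.
Proof.
move=> be_gt0 be_ga n_gt0 n_lt.
rewrite /keeps_descending /rises /falls /gain /loss -!subnDA !add0n.
beyond n (be + ga + (a + t)).
beyond n (be + ga + (a + t + t)).
beyond n (a + (be + t) + (ga + t)).
split_at n (be + ga); split_at n (be + t);
  split_at n (ga + t); split_at n (be + ga + t); split_at n (be + ga + (t + t));
  split_at n (be + t + (ga + t)); split_at n a;
  split_at n (a + (be + t)); split_at n (a + (ga + t)); split_at n (be + ga + a).
all: lia.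
Qed.

Lemma gain_swap12 a b c n : gain b a c n = gain a b c n.
Proof. by rewrite /gain (addnC b a); lia. Qed.

Lemma loss_swap12 a b c n : loss b a c n = loss a b c n.
Proof. by rewrite /loss (addnC b a); lia. Qed.

Lemma gain_swap23 a b c n : gain a c b n = gain a b c n.
Proof. by rewrite /gain (addnC c b); lia. Qed.

Lemma loss_swap23 a b c n : loss a c b n = loss a b c n.
Proof. by rewrite /loss (addnAC a c b); lia. Qed.

Lemma keeps_descending_swap12 al be ga ta tb tc n :
  keeps_descending be al ga tb ta tc n -> keeps_descending al be ga ta tb tc n.
Proof.
rewrite /keeps_descending /rises /falls.
by rewrite !(gain_swap12 (al + ta)) !(loss_swap12 (al + ta)) !(gain_swap12 ta)
  !(loss_swap12 ta) (addnC be al).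
Qed.

Lemma keeps_descending_swap23 al be ga ta tb tc n :
  keeps_descending al ga be ta tc tb n -> keeps_descending al be ga ta tb tc n.
Proof.
rewrite /keeps_descending /rises /falls.
by rewrite !(gain_swap23 _ (be + tb)) !(loss_swap23 _ (be + tb))
  !(gain_swap23 _ tb) !(loss_swap23 _ tb) (addnAC al ga be).
Qed.

(** The second group says that at least two variables occur in the mixed generator. The third gives
    the degrees of the possible socle monomials; [e + 3] compensates for lowering three exponents by
    one. *)
Definition level_exponents al be ga ta tb tc e :=
  [/\ [/\ 0 < ta, 0 < tb & 0 < tc],
      [/\ 0 < al + be, 0 < al + ga & 0 < be + ga]
    & [/\ 0 < al -> al + (be + tb) + (ga + tc) = e + 3,
          0 < be -> (al + ta) + be + (ga + tc) = e + 3
        & 0 < ga -> (al + ta) + (be + tb) + ga = e + 3]].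

(** Comparing the degree equations gives [tb = tc], and also [ta = tb] if [al] is positive. *)
Lemma keeps_descending_sorted al be ga ta tb tc e n :
    level_exponents al be ga ta tb tc e -> al <= be -> be <= ga ->
  0 < n -> n <= e -> keeps_descending al be ga ta tb tc n.
Proof.
move=> [[ta0 tb0 tc0] [ab ac bc] [ea eb ec]] al_be be_ga n0 ne.
have be0 : 0 < be by lia.
have ga0 : 0 < ga by lia.
have {}eb := eb be0; have {}ec := ec ga0.
have tbc : tc = tb by lia.
rewrite tbc in eb ec ea *.
have [al0|al_gt0] := posnP al.
  by rewrite al0 in eb ec *; apply: keeps_descending_zero => //; lia.
have {}ea := ea al_gt0; have -> : ta = tb by lia.
by apply: keeps_descending_pos => //; lia.
Qed.

Lemma keeps_descending_level al be ga ta tb tc e n :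
    level_exponents al be ga ta tb tc e ->
  0 < n -> n <= e -> keeps_descending al be ga ta tb tc n.
Proof.
move=> lev n0 ne.
have sorted := keeps_descending_sorted _ _ _ n0 ne.
have [ab|/ltnW ab] := leqP al be; have [bc|/ltnW bc] := leqP be ga.
- exact: sorted.
- apply: keeps_descending_swap23; have [ac|/ltnW ac] := leqP al ga.
    by apply: sorted => //; case: lev => [[? ? ?] [? ? ?] [? ? ?]]; split; split; lia.
  apply: keeps_descending_swap12.
  by apply: sorted => //; case: lev => [[? ? ?] [? ? ?] [? ? ?]]; split; split; lia.
- apply: keeps_descending_swap12; have [ac|/ltnW ac] := leqP al ga.
    by apply: sorted => //; case: lev => [[? ? ?] [? ? ?] [? ? ?]]; split; split; lia.
  apply: keeps_descending_swap23.
  by apply: sorted => //; case: lev => [[? ? ?] [? ? ?] [? ? ?]]; split; split; lia.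
- apply: keeps_descending_swap12; apply: keeps_descending_swap23.
  apply: keeps_descending_swap12.
  by apply: sorted => //; case: lev => [[? ? ?] [? ? ?] [? ? ?]]; split; split; lia.
Qed.

(** The peak runs from the first degree [s] where [h] stops rising to the first degree [q] from [s]
    on where it falls. *)
Lemma peaked_of_descending (h : nat -> nat) e :
    (forall i, i.+1 < e -> h i.+1 <= h i -> h i.+2 <= h i.+1) ->
    (forall i, i.+1 < e -> h i.+1 < h i -> h i.+2 < h i.+1) ->
  peaked_strictly_unimodal h e.
Proof.
move=> weak strict.
have weak_from s : h s.+1 <= h s -> forall i, s <= i < e -> h i.+1 <= h i.
  move=> hs; elim=> [|i IH] /andP[si ie]; first by case: s si hs.
  have [<- //|ne] := eqVneq s i.+1.
  by apply: weak => //; apply: IH; lia.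
have strict_from s : h s.+1 < h s -> forall i, s <= i < e -> h i.+1 < h i.
  move=> hs; elim=> [|i IH] /andP[si ie]; first by case: s si hs.
  have [<- //|ne] := eqVneq s i.+1.
  by apply: strict => //; apply: IH; lia.
have first (P : pred nat) :
    exists2 s, s <= e & (forall i, i < s -> ~~ P i) /\ (s < e -> P s).
  (* [find] returns [e] when no degree qualifies, which covers an [h] that never stops rising or
     never falls before [e]. *)
  exists (find P (iota 0 e)); first by rewrite -{2}(size_iota 0 e) find_size.
  split=> [i i_lt|s_lt].
    have := before_find 0 i_lt; rewrite nth_iota ?add0n => [->//|].
    by rewrite (leq_trans i_lt) // -{2}(size_iota 0 e) find_size.
  have : has P (iota 0 e) by rewrite has_find size_iota.
  by move/(nth_find 0); rewrite nth_iota.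
have [s se [up_s top_s]] := first (fun i => h i.+1 <= h i).
have [q qe [up_q top_q]] := first (fun i => (s <= i) && (h i.+1 < h i)).
have sq : s <= q.
  case: (ltnP q e) => [/top_q/andP[]//|eq]; exact: leq_trans eq.
exists s, (q - s).+1; have -> : s + (q - s).+1 - 1 = q by lia.
split=> [|i /up_s|i si iq|i qi ie].
- by split.
- by rewrite -ltnNge.
- have := up_q i iq; rewrite si /= -leqNgt => le.
  apply/eqP; rewrite eqn_leq le; apply: (weak_from s); last by rewrite si; lia.
  by apply: top_s; lia.
- have [_ hq] := andP (top_q (leq_ltn_trans qi ie)).
  by apply: (strict_from q) => //; rewrite qi.
Qed.

Lemma staircase_peaked al be ga ta tb tc e :
    level_exponents al be ga ta tb tc e ->
  peaked_strictly_unimodal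
    (staircase (al + ta) (be + tb) (ga + tc) al be ga) e.
Proof.
move=> lev; set h := staircase _ _ _ _ _ _.
have step := @staircase_diff al be ga ta tb tc; rewrite -/h /= in step.
(* The step from [i] to [i.+1] is read at [n = i.+2], so [ie] is exactly [n <= e]. *)
apply: peaked_of_descending => i ie hi;
  have [] := keeps_descending_level lev (isT : 0 < i.+2) ie;
  have := step i; have := step i.+1; lia.
Qed.
End BoxCounts.

(** * From monomials in three variables to staircase counts *)

Section ThreeVariables.
Local Open Scope nat_scope.
Local Notation x := (ord0 : 'I_3).
Local Notation y := (lift ord0 (ord0 : 'I_2) : 'I_3).
Local Notation z := (lift ord0 (lift ord0 (ord0 : 'I_1)) : 'I_3).

Lemma ord3_cases (i : 'I_3) : [\/ i = x, i = y | i = z].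
Proof.
case: i => [[|[|[|//]]] i_lt]; [apply: Or31|apply: Or32|apply: Or33];
  exact: val_inj.
Qed.

Lemma mdeg3 (m : 'X_{1..3}) : mdeg m = m x + m y + m z.
Proof. by rewrite mdegE !big_ord_recl big_ord0 addn0 addnA. Qed.

Lemma hilbert_staircase (K : fieldType) (I : idealr {mpoly K[3]})
    (a : 'I_3 -> nat) (m0 : 'X_{1..3}) d :
    monomial_ideal I ->
    (forall m, 'X_[m] \in I <-> (exists i, a i <= m i) \/ (m0 <= m)%MM) ->
  hilbert I d = staircase (a x) (a y) (a z) (m0 x) (m0 y) (m0 z) d.
Proof.
move=> monI memI.
pose box := ('I_(a x) * 'I_(a y) * 'I_(a z))%type.
pose P (u : box) := (u.1.1 + u.1.2 + u.2 == d) &&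
  ~~ [&& m0 x <= u.1.1, m0 y <= u.1.2 & m0 z <= u.2].
pose mon (u : box) := [multinom [tuple val u.1.1; val u.1.2; val u.2]].
have monx u : mon u x = u.1.1 by [].
have mony u : mon u y = u.1.2 by [].
have monz u : mon u z = u.2 by [].
have mon_inj : injective mon.
  move=> [[i j] k] [[i' j'] k'] eq_mon.
  have := congr1 (fun m : 'X_{1..3} => m x) eq_mon.
  have := congr1 (fun m : 'X_{1..3} => m y) eq_mon.
  have := congr1 (fun m : 'X_{1..3} => m z) eq_mon.
  by rewrite !monx !mony !monz /= => /val_inj -> /val_inj -> /val_inj ->.
have le3 (m l : 'X_{1..3}) : (m <= l)%MM = [&& m x <= l x, m y <= l y & m z <= l z].
  apply/mnm_lepP/and3P => [ml|[lx ly lz] i]; first by split; apply: ml.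
  by case: (ord3_cases i) => ->.
rewrite (hilbert_monomial monI (ms := [seq mon u | u : box in P])).
- rewrite size_map -cardE -sum1_card big_mkcond /=.
  rewrite /staircase pair_bigA pair_bigA /=; apply: eq_bigr => -[[i j] k] _ /=.
  by rewrite unfold_in /P /=; case: ifP.
- by rewrite map_inj_uniq // enum_uniq.
move=> m; apply/mapP/andP => [[u]|[md mI]].
  rewrite mem_enum => Pu ->; have /andP[ud um0] := Pu.
  split; first by rewrite mdeg3 monx mony monz.
  apply/negP => /memI[[i]|]; last by rewrite le3 monx mony monz (negPf um0).
  by case: (ord3_cases i) => ->; rewrite ?monx ?mony ?monz leqNgt ltn_ord.
have m_lt i : m i < a i.
  by rewrite ltnNge; apply: contraNN mI => ai; apply/memI; left; exists i.
pose u : box := (Ordinal (m_lt x), Ordinal (m_lt y), Ordinal (m_lt z)).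
exists u; last by apply/mnmP => i; case: (ord3_cases i) => ->.
rewrite mem_enum unfold_in /P /= -mdeg3 md /= -le3.
by apply: contraNN mI => m0m; apply/memI; right.
Qed.

End ThreeVariables.

Theorem theorem5p3 (K : fieldType) (I : idealr {mpoly K[3]}) (e : nat)
  (hI : level_artinian_monomial_aci I e) :
  peaked_strictly_unimodal (hilbert I) e.
Proof.
have [monI art gens lev] := hI.
have [a [m0 [m0_lt m0_two memI]]] := monomial_aci_shape monI art gens.
have socle := socle_deg_shape monI lev m0_lt memI.
pose x : 'I_3 := ord0; pose y : 'I_3 := lift ord0 ord0.
pose z : 'I_3 := lift ord0 (lift ord0 ord0).
have hilbE d := hilbert_staircase d monI memI.
have aE i : a i = (m0 i + (a i - m0 i))%N by rewrite subnKC // ltnW.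
suff peaked : peaked_strictly_unimodal
    (staircase (a x) (a y) (a z) (m0 x) (m0 y) (m0 z)) e.
  case: peaked => s [p [? ? ? ?]]; exists s, p.
  by split=> // i *; rewrite !hilbE; auto.
rewrite (aE x) (aE y) (aE z); apply: staircase_peaked.
have ltx := m0_lt x; have lty := m0_lt y; have ltz := m0_lt z.
have cases : forall i : 'I_3, [\/ i = x, i = y | i = z] := ord3_cases.
split; first by split; lia.
  (* Each variable has another one occurring in [m0], so no two exponents of [m0] vanish
     together. *)
  have [j jx mj] := m0_two x; have [k ky mk] := m0_two y.
  have [l lz ml] := m0_two z.
  case: (cases j) jx mj => -> // _ mj; case: (cases k) ky mk => -> // _ mk;
  case: (cases l) lz ml => -> // _ ml; split; lia.
rewrite -!aE; split=> [/[dup] mi /(socle x)|/[dup] mi /(socle y)|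
                       /[dup] mi /(socle z)];
  rewrite big_mkcond !big_ord_recl big_ord0 /= -/x -/y -/z; lia.
Qed.
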